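(* Let $\alpha$ be a probability distribution on $[d]$ with $\alpha_1\ge\cdots\ge\alpha_d$ and $\alpha_1,\dots,\alpha_k>0$, let $n\ge1$, $k\in[d]$, $\lambda\sim\mathrm{SW}^n(\alpha)$, $\underline\lambda=\lambda/n$. Then \[ \mathbb E\Big[\sum_{i=1}^k\alpha_i\Big(\frac{\underline\lambda_i}{\alpha_i}-1\Big)^2\Big]\le\frac{46kd}{n} \quad\text{and}\quad \mathbb E\Big[\sum_{i=1}^k\big(\sqrt{\underline\lambda_i}-\sqrt{\alpha_i}\big)^2\Big]\le\frac{46kd}{n}. \]
   Context: $\mathrm{SW}^n(\alpha)$ is the law of the RSK shape $\mathrm{shRSK}(\boldsymbol w)$ (Young diagram $\lambda_1\ge\cdots\ge\lambda_d\ge0$ whose first $k$ rows sum to the maximum total length of $k$ disjoint weakly increasing subsequences of $\boldsymbol w$), where $\boldsymbol w\in[d]^n$ has i.i.d. letters with law $\alpha$. *)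

(* Defs.v *)
From HB Require Import structures.
From mathcomp Require Import all_boot all_order all_algebra.
Set Implicit Arguments. Unset Strict Implicit. Unset Printing Implicit Defensive.
Import Order.TTheory GRing.Theory Num.Theory.

(* Words w in [d]^n are finite functions 'I_n -> 'I_d (letters 0-indexed).
   A family of k disjoint weakly increasing subsequences of w is encoded by a
   colouring c : 'I_n -> option 'I_k (None = position unused; positions with
   colour j form the j-th subsequence, which must be weakly increasing). *)
Definition incr_family (d n k : nat) (w : {ffun 'I_n -> 'I_d})
  (c : {ffun 'I_n -> option 'I_k}) : bool :=
  [forall i1 : 'I_n, forall i2 : 'I_n,
     [&& (i1 < i2)%N, c i1 != None & c i1 == c i2] ==> (w i1 <= w i2)%N].

Definition greene (d n k : nat) (w : {ffun 'I_n -> 'I_d}) : nat :=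
  \max_(c : {ffun 'I_n -> option 'I_k} | incr_family w c) #|[set i | c i != None]|.

(* RSK shape: lambda_(i+1) (0-indexed i) = G_(i+1)(w) - G_i(w), so that the
   first k rows sum to G_k(w). *)
Definition shRSK (d n : nat) (w : {ffun 'I_n -> 'I_d}) (i : 'I_d) : nat :=
  greene i.+1 w - greene i w.

Definition SW_expect (R : numDomainType) (d n : nat) (alpha : 'I_d -> R)
  (F : ('I_d -> nat) -> R) : R :=
  (\sum_(w : {ffun 'I_n -> 'I_d}) (\prod_(t : 'I_n) alpha (w t)) * F (shRSK w))%R.

(* Main.v *)
Require Import Defs.
From HB Require Import structures.
From mathcomp Require Import all_boot all_order all_algebra.
From mathcomp Require Import zify ring lra.
Import Order.TTheory GRing.Theory Num.Theory.
Set Implicit Arguments.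
Unset Strict Implicit.
Unset Printing Implicit Defensive.

(** Write [a] for [alpha i] (rows and letters are 0-indexed).  It suffices to
    show, for each row separately, E (lambda_i - a n)^2 <= 22 a d n.

    Row [i] is squeezed between two last-passage quantities.  From above,
    lambda_i is at most the longest weakly increasing subsequence in the letters
    >= i.  From below, lambda_i is at least the minimum, over paths which visit
    the rows 0, ..., i in this order, of the number of letters met in their own
    row.  Both follow from a canonical decomposition of a set of letters into k
    increasing sequences.

    Reading the word letter by letter, the two quantities evolve as a pushing and
    as a blocking exclusion process, i.e. as queues in tandem whose rates are at
    most a, respectively at least a.  Adding a source of rate
    beta = a + s / n, respectively beta = a - s / n, with s = sqrt (a d n), gives a
    stationary system with independent geometric gaps.  The expected last-passage
    value started from the current configuration glued to independent geometric
    gaps is then a Lyapunov function: its increments lie in [0, 1], its drift is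
    at most (at least) beta, and the gaps shift its initial value by at most s.  A
    martingale-type second moment bound concludes.  To avoid infinite sums over
    geometric laws, which make no sense in a general real closed field, only the
    tail probabilities of the glued value are used; they satisfy a finite
    recursion. *)

(** * Greene invariants and last-passage percolation *)

Lemma down_ind n (P : nat -> Prop) :
  P n -> (forall t : 'I_n, P t.+1 -> P t) -> forall t, t <= n -> P t.
Proof.
move=> Pn PS t; move: {2}(n - t) (erefl (n - t)) => m.
elim: m t => [|m IH] t hm ht; first by have -> : t = n by lia.
have htn : t < n by lia.
by apply: (PS (Ordinal htn)); apply: IH => /=; lia.
Qed.

Definition scan {T S : Type} (step : T -> S -> S) (z : S) {n} (g : 'I_n -> T)
  (t : nat) : S := foldr step z (drop t (codom g)).

Lemma scan_end T S (step : T -> S -> S) z n (g : 'I_n -> T) t :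
  n <= t -> scan step z g t = z.
Proof. by move=> ht; rewrite /scan drop_oversize // size_codom card_ord. Qed.

Lemma scanE T S (step : T -> S -> S) z n (g : 'I_n -> T) (t : 'I_n) :
  scan step z g t = step (g t) (scan step z g t.+1).
Proof.
rewrite /scan (drop_nth (g t)) ?size_codom ?card_ord //=.
by rewrite codomE (nth_map t) ?size_enum_ord // nth_ord_enum.
Qed.

(** * Canonical decomposition into increasing sequences *)

Section Rank.
Variables (n : nat) (w : 'I_n -> nat) (b : pred 'I_n).

Definition decr_step (a : nat) (N : nat -> nat) (x : nat) : nat :=
  if a < x then maxn (N x) (N a).+1 else N x.

(* rank t x is the greatest length of a strictly decreasing subsequence formed
   by letters < x at used positions >= t.  The used positions u sharing the value
   of rank u.+1 (w u) carry a weakly increasing sequence, which is the canonical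
   decomposition into the least number of such sequences. *)
Definition rank : nat -> nat -> nat :=
  scan (fun p N => if p.2 then decr_step p.1 N else N) (fun=> 0)
    (fun t => (w t, b t)).

Lemma rankE (t : 'I_n) :
  rank t = if b t then decr_step (w t) (rank t.+1) else rank t.+1.
Proof. exact: scanE. Qed.

Lemma rank_end t x : n <= t -> rank t x = 0.
Proof. by move=> h; rewrite /rank scan_end. Qed.

Lemma rankP (P : (nat -> nat) -> Prop) :
  P (fun=> 0) -> (forall a N, P N -> P (decr_step a N)) -> forall t, P (rank t).
Proof.
move=> P0 PS t; have [ht|ht] := leqP n t; first by rewrite /rank scan_end.
apply: (@down_ind n (fun t => P (rank t))); last exact: ltnW.
  by rewrite /rank scan_end.
by move=> u IH; rewrite rankE; case: ifP => _ //; apply: PS.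
Qed.

Lemma rank_mono t x y : x <= y -> rank t x <= rank t y.
Proof.
move: x y; apply: (@rankP (fun N => forall x y, x <= y -> N x <= N y)) => //.
move=> a N IH x y xy; rewrite /decr_step.
have h1 := IH _ _ xy; case: ltnP => h; case: ltnP => h' //; lia.
Qed.

Lemma rankS_le t x : rank t x.+1 <= (rank t x).+1.
Proof.
suff [] : rank t 0 = 0 /\ forall x, rank t x.+1 <= (rank t x).+1 by [].
apply: (@rankP (fun N => N 0 = 0 /\ forall x, N x.+1 <= (N x).+1)) => //.
move=> a N [N0 IH]; split=> // y; rewrite /decr_step.
have := IH y; case: (ltnP a y.+1) => h; case: (ltnP a y) => h'; try lia.
have -> : y = a by lia.
by rewrite geq_max leqnn => ->.
Qed.

Lemma rank_le_id t x : rank t x <= x.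
Proof.
elim: x => [|x IH]; last by apply: leq_trans (rankS_le t x) _.
by apply: (@rankP (fun N => N 0 <= 0)).
Qed.

Lemma rank_anti t t' x : t <= t' -> rank t' x <= rank t x.
Proof.
move=> /subnKC <-; elim: (t' - t) => [|m IH]; first by rewrite addn0.
apply: leq_trans IH; rewrite addnS.
have [h|h] := leqP n (t + m); first by rewrite !rank_end //; lia.
rewrite -[X in _ <= rank X _]/(nat_of_ord (Ordinal h)) rankE /=.
case: ifP => _ //; rewrite /decr_step; case: ifP => // _; lia.
Qed.

Lemma rank_used (t : 'I_n) t' x :
  t' <= t -> b t -> w t < x -> rank t.+1 (w t) < rank t' x.
Proof.
move=> h bt wx; apply: leq_trans (rank_anti x h).
by rewrite rankE bt /decr_step wx leq_maxr.
Qed.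

(** [rank t] stays weakly below the diagonal, so a value strictly below it at [x.+1] forces a letter
    [m] at which the diagonal is left. *)
Lemma rank_mex t x : rank t x.+1 <= x ->
  exists2 m, m <= x & rank t m = m /\ rank t m.+1 = m.
Proof.
elim: x => [|x IH] hx.
  by exists 0 => //; have := rank_le_id t 0; split; lia.
have [/IH [m hm ?]|hx'] := leqP (rank t x.+1) x; first by exists m => //; lia.
exists x.+1 => //; have := rank_le_id t x.+1.
have := rank_mono t (leqnSn x.+1); split; lia.
Qed.

End Rank.

(** * Pushing and blocking dynamics of the rows *)

Section Dynamics.
Variable d : nat.

(** Pushing: row [a] rises by one and lifts every later row that it would overtake. *)
Definition up_step (a : nat) (l : nat -> nat) (j : nat) : nat :=
  if a <= j then maxn (l j) (l a).+1 else l j.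

(* Row j holds the greatest length of a weakly increasing subsequence of s
   whose letters are at least d.-1 - j. *)
Definition chain_state (s : seq 'I_d) : nat -> nat :=
  foldr (fun a : 'I_d => up_step (d.-1 - a)) (fun=> 0) s.

Lemma chain_state_mono s i j : i <= j -> chain_state s i <= chain_state s j.
Proof.
elim: s i j => //= a s IH i j ij; rewrite /up_step.
have h := IH _ _ ij; case: (leqP (d.-1 - a) i) => hi; case: (leqP (d.-1 - a) j) => hj; lia.
Qed.

Lemma chain_state_le_count s j :
  chain_state s j <= count (fun a : 'I_d => d.-1 - a <= j) s.
Proof.
elim: s j => //= a s IH j.
rewrite [up_step _ _ _]/up_step; case: (leqP (d.-1 - a) j) => h; last exact: IH.
rewrite add1n geq_max leqW ?IH //= ltnS; apply: leq_trans (IH _) _.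
by apply: sub_count => c /= hc; apply: leq_trans h.
Qed.

(** Blocking, for weakly increasing heights: row [a] falls by one unless row [a - 1] stands equally
    high. The default 0 leaves row 0 unblocked. *)
Definition down_step (a : nat) (l : nat -> nat) (j : nat) : nat :=
  if j == a then maxn (l j).-1 (if j is i.+1 then l i else 0) else l j.

(* n minus row j is the least number of letters met by a path which visits the
   rows 0, ..., j in this order while s is read from its end, and meets a
   letter when it sits in the row of this letter. *)
Definition gap_state (n : nat) (s : seq 'I_d) : nat -> nat :=
  foldr (fun a : 'I_d => down_step a) (fun=> n) s.

Lemma down_step_ge l b j : (l j).-1 <= down_step b l j.
Proof. by rewrite /down_step; case: eqP => // _; [exact: leq_maxl | lia]. Qed.

Lemma down_step_le l b j : (forall i j, i <= j -> l i <= l j) ->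
  down_step b l j <= l j.
Proof.
move=> lP; rewrite /down_step; case: eqP => // _; rewrite geq_max.
by case: j => [|j]; rewrite ?leq0n ?andbT ?lP //; lia.
Qed.

Lemma down_step_mono a (l : nat -> nat) :
  (forall i j, i <= j -> l i <= l j) ->
  forall i j, i <= j -> down_step a l i <= down_step a l j.
Proof.
move=> lP i j ij; rewrite /down_step.
have [ia|ia] := eqVneq i a; have [ja|ja] := eqVneq j a.
- by have -> : i = j by lia.
- rewrite geq_max; apply/andP; split; first by have := lP _ _ ij; lia.
  by case: i ij {ia} => // i ij; apply: lP; lia.
- case: j ij ja => [|j] ij ja; first by lia.
  by rewrite leq_max lP ?orbT; lia.
- exact: lP.
Qed.

Lemma gap_state_mono n s i j : i <= j -> gap_state n s i <= gap_state n s j.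
Proof. by elim: s i j => //= a s IH i j ij; apply: down_step_mono. Qed.

Lemma gap_state_le n s j : gap_state n s j <= n.
Proof.
elim: s j => //= a s IH j; apply: leq_trans (IH j).
by apply: down_step_le; apply: gap_state_mono.
Qed.

Lemma gap_state_ge n s j : n - size s <= gap_state n s j.
Proof.
elim: s j => [|a s IH] j /=; first by rewrite subn0.
by apply: leq_trans (down_step_ge _ _ _); have := IH j; lia.
Qed.

End Dynamics.

(** * Rows of the shape bounded by the two dynamics *)

Section Greene.
Variables (d n : nat) (w : {ffun 'I_n -> 'I_d}).

Lemma incr_familyP k (c : {ffun 'I_n -> option 'I_k}) :
  reflect (forall i1 i2 : 'I_n, i1 < i2 -> c i1 != None -> c i1 = c i2 ->
             w i1 <= w i2) (incr_family w c).
Proof.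
apply: (iffP forallP) => [H i1 i2 lt12 n1 e12|H i1].
  by have /forallP/(_ i2)/implyP := H i1; apply; rewrite lt12 n1 e12 eqxx.
by apply/forallP => i2; apply/implyP => /and3P[? ? /eqP ?]; apply: H.
Qed.

Lemma greene_attained k : exists2 c : {ffun 'I_n -> option 'I_k},
  incr_family w c & greene k w = #|[set i | c i != None]|.
Proof.
have [|c cP e] := @eq_bigmax_cond _
    (fun c : {ffun 'I_n -> option 'I_k} => incr_family w c)
    (fun c => #|[set i | c i != None]|).
  apply/card_gt0P; exists [ffun=> None]; apply/incr_familyP => i1 i2 _.
  by rewrite ffunE.
by exists c => //; rewrite -e.
Qed.

Lemma greene_ge k (b : pred 'I_n) (col : 'I_n -> nat) :
  (forall t, b t -> col t < k) ->
  (forall t1 t2 : 'I_n, t1 < t2 -> b t1 -> b t2 -> col t1 = col t2 ->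
     w t1 <= w t2) ->
  #|[set t | b t]| <= greene k w.
Proof.
move=> colk colP.
pose c := [ffun t => if b t then insub (col t) else None] : {ffun 'I_n -> option 'I_k}.
have cN t : (c t != None) = b t.
  rewrite ffunE; case: ifP => // bt.
  by case: insubP => //; rewrite (colk _ bt).
have cP : incr_family w c.
  apply/incr_familyP => t1 t2 lt12; rewrite cN => b1 e12.
  have b2 : b t2 by rewrite -cN -e12 cN.
  apply: colP => //; move: e12; rewrite !ffunE b1 b2.
  by rewrite !insubT ?colk // => ? ? [].
have <- : [set t | c t != None] = [set t | b t] by apply/setP => t; rewrite !inE cN.
exact: (@leq_bigmax_cond _ (fun c => incr_family w c) (fun c => #|[set i | c i != None]|)).
Qed.

Let x (t : 'I_n) : nat := w t.

(** A strictly decreasing subsequence meets each colour at most once. The induction compares [rank]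
    with the number of colours seen on letters below [z]: the colour at [u] cannot recur later on a
    smaller letter. *)
Lemma rank_family k (c : {ffun 'I_n -> option 'I_k}) y :
  incr_family w c -> rank x (fun t => c t != None) 0 y <= k.
Proof.
move=> /incr_familyP cP; set b := fun t => _.
pose A t z := [set j : 'I_k | [exists u : 'I_n, [&& t <= u, c u == Some j & x u < z]]].
suff H t : t <= n -> forall z, rank x b t z <= #|A t z|.
  by apply: leq_trans (H 0 _ y) _ => //; rewrite -[X in _ <= X]card_ord max_card.
apply: (@down_ind n (fun t => forall z, rank x b t z <= #|A t z|)) => [z|u IH z].
  by rewrite rank_end.
have sub z1 z2 : z1 <= z2 -> A u.+1 z1 \subset A u z2.
  move=> hz; apply/subsetP => j; rewrite !inE => /existsP[v /and3P[h1 h2 h3]].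
  by apply/existsP; exists v; rewrite h2 /=; lia.
rewrite rankE; case: ifP => bu; last first.
  by apply: leq_trans (IH z) _; apply/subset_leq_card/sub.
rewrite /decr_step; case: ltnP => xz; last first.
  by apply: leq_trans (IH z) _; apply/subset_leq_card/sub.
rewrite geq_max; apply/andP; split.
  by apply: leq_trans (IH z) _; apply/subset_leq_card/sub.
apply: leq_ltn_trans (IH _) _; apply/proper_card/properP; split.
  by apply: sub; apply: ltnW.
case cu : (c u) => [j|]; last by move: bu; rewrite /b cu.
exists j; first by rewrite inE; apply/existsP; exists u; rewrite leqnn cu eqxx.
rewrite inE; apply/negP => /existsP[v /and3P[uv /eqP cv]].
by rewrite ltnNge (cP u v) // cu ?cv.
Qed.


(** A smaller used letter at [t2] would extend the decreasing sequences counted at [t1], so the two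
    ranks would differ. *)
Lemma rank_incr (b : pred 'I_n) (t1 t2 : 'I_n) : t1 < t2 -> b t2 ->
  rank x b t1.+1 (x t1) = rank x b t2.+1 (x t2) -> x t1 <= x t2.
Proof.
move=> lt12 b2 e; rewrite leqNgt; apply/negP => lt21.
by have := rank_used lt12 b2 lt21; rewrite e ltnn.
Qed.

Lemma chain_le (v : pred 'I_n) :
  (forall t1 t2 : 'I_n, t1 < t2 -> v t1 -> v t2 -> x t1 <= x t2) ->
  forall j, #|[set t | v t && (d.-1 - x t <= j)]| <= chain_state (codom w) j.
Proof.
move=> vP; pose A t j := [set u : 'I_n | [&& t <= u, v u & d.-1 - x u <= j]].
pose l := scan (fun a : 'I_d => up_step (d.-1 - a)) (fun=> 0) w.
suff H t : t <= n -> forall j, #|A t j| <= l t j.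
  move=> j; have := H 0 (leq0n _) j; rewrite /l /scan drop0.
  by congr (_ <= _); apply: eq_card => u; rewrite !inE.
apply: (@down_ind n (fun t => forall j, #|A t j| <= l t j)) => [j|u IH j].
  rewrite /l scan_end // leqn0 cards_eq0; apply/eqP/setP => u; rewrite !inE.
  by rewrite leqNgt ltn_ord.
rewrite /l scanE -/l /up_step.
have [vu|vu] := boolP (v u && (d.-1 - x u <= j)); last first.
  have -> : A u j = A u.+1 j.
    apply/setP => s; rewrite !inE; have [->|ne] := eqVneq s u.
      by rewrite leqnn ltnn; apply/negbTE.
    by rewrite [RHS]andbC [in RHS]ltn_neqAle eq_sym ne /= andbC.
  apply: leq_trans (IH j) _; case: ifP => // _; exact: leq_maxl.
have {vu} [vu xj] := andP vu; rewrite xj.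
(* The letters of the chain after [u] are at least [x u], so for them the bound [j] sharpens to
   [d.-1 - x u]. *)
have -> : A u j = u |: A u.+1 (d.-1 - x u).
  apply/setP => s; rewrite !inE; have [->|ne] := eqVneq s u.
    by rewrite leqnn vu.
  have -> : (u <= s) = (u < s) by rewrite [RHS]ltn_neqAle eq_sym ne.
  rewrite /=; case: ltnP => //= us; case vs : (v s) => //=.
  by have := vP _ _ us vu vs; move: xj; lia.
by rewrite cardsU1 leq_max !inE ltnn /= add1n ltnS IH orbT.
Qed.

(* Letters of colour k are at least k because rank t z <= z, so the last
   colour class is a chain in the alphabet {k, ..., d-1}. *)
Lemma greene_succ_le k : k < d ->
  greene k.+1 w <= greene k w + chain_state (codom w) (d.-1 - k).
Proof.
move=> kd; have [c cP ->] := greene_attained k.+1.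
set b := fun t => c t != None.
pose col (t : 'I_n) := rank x b t.+1 (x t).
have colk t : b t -> col t <= k.
  move=> bt; rewrite -ltnS; apply: leq_trans (rank_family d cP).
  exact: (@rank_used n x b t 0 d (leq0n t) bt (ltn_ord (w t))).
rewrite -(cardsID [set t | col t < k]); apply: leq_add.
  apply: leq_trans (greene_ge (k := k) (b := fun t => b t && (col t < k)) (col := col) _ _).
  - by apply/subset_leq_card/subsetP => t; rewrite !inE.
  - by move=> t /andP[].
  by move=> t1 t2 lt12 _ /andP[b2 _]; apply: rank_incr.
pose v t := b t && (col t == k).
apply: leq_trans (chain_le (v := v) _ _).
  apply/subset_leq_card/subsetP => t; rewrite !inE /v -leqNgt => /andP[h bt].
  rewrite bt eqn_leq h colk //=; have := rank_le_id x b t.+1 (x t).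
  by rewrite -/(col t); lia.
move=> t1 t2 lt12 /andP[b1 /eqP e1] /andP[b2 /eqP e2].
by apply: (@rank_incr b) => //; rewrite -/(col t1) -/(col t2) e1 e2.
Qed.

(* While reading the word from the end, m is the least letter missing from the
   heads of the k increasing sequences; letters equal to m which are not yet
   used can all be added at the price of one more colour. *)
Lemma greene_succ_ge k : k < d ->
  n + greene k w <= greene k.+1 w + gap_state n (codom w) k.
Proof.
move=> kd; have [c cP ->] := greene_attained k.
set b := fun t => c t != None.
pose N t := rank x b t.
pose ex (t : 'I_n) := [&& ~~ b t, N t.+1 (x t) == x t & N t.+1 (x t).+1 == x t].
pose l := scan (fun a : 'I_d => down_step a) (fun=> n) w.
have Nk t y : N t y <= k.
  by apply: leq_trans (rank_family y cP); apply: rank_anti.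
have lmono t : t <= n -> forall i j, i <= j -> l t i <= l t j.
  apply: (@down_ind n (fun t => forall i j, i <= j -> l t i <= l t j)).
    by move=> i j _; rewrite /l !scan_end.
  by move=> u IH i j ij; rewrite /l scanE; apply: down_step_mono.
have cnt t : t <= n -> forall m, N t m = m -> N t m.+1 = m ->
    n <= #|[set u : 'I_n | (t <= u) && ex u]| + l t m.
  move: t; apply: down_ind => [m _ _|u IH m]; first by rewrite /l scan_end // leq_addl.
  have sub : [set t : 'I_n | (u < t) && ex t] \subset [set t : 'I_n | (u <= t) && ex t].
    by apply/subsetP => t; rewrite !inE => /andP[/ltnW -> ->].
  rewrite /N rankE /l scanE -/l; case: ifP => bu Nm Nm1.
    have um : m != w u.
      apply/eqP => um; move: Nm1 Nm; rewrite /decr_step /x -um ltnSn ltnn; lia.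
    have [m' hm [h1 h2]] : exists2 m', m' <= m & N u.+1 m' = m' /\ N u.+1 m'.+1 = m'.
      apply: rank_mex; rewrite -{2}Nm1 /decr_step; case: ifP => // _; exact: leq_maxl.
    have := IH m' h1 h2; have := lmono u.+1 (ltn_ord u) _ _ hm.
    have := subset_leq_card sub; rewrite /down_step (negbTE um); lia.
  have := IH m Nm Nm1; rewrite /down_step; have [um|um] := eqVneq; last first.
    by have := subset_leq_card sub; lia.
  have exu : ex u by rewrite /ex bu /x -um /N Nm Nm1 eqxx.
  have -> : [set t : 'I_n | (u <= t) && ex t] = u |: [set t : 'I_n | (u < t) && ex t].
    apply/setP => t; rewrite !inE [in RHS]ltn_neqAle.
    by have [->|ne] := eqVneq t u; rewrite ?leqnn ?exu //= eq_sym ne.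
  rewrite cardsU1 inE ltnn /=; lia.
have [m mk [h1 h2]] : exists2 m, m <= k & N 0 m = m /\ N 0 m.+1 = m.
  exact/rank_mex/Nk.
have := cnt 0 (leq0n n) m h1 h2; have := lmono 0 (leq0n n) _ _ mk.
have -> : l 0 k = gap_state n (codom w) k by rewrite /l /scan drop0.
(* Used letters whose rank equals their value keep that colour; the other used letters move up by
   one. This frees the missing value as a colour for the extra letters. *)
pose col (t : 'I_n) := if N t.+1 (x t) == x t then x t else (N t.+1 (x t)).+1.
have : #|[set t | b t || ex t]| <= greene k.+1 w.
  apply: (greene_ge (col := col)) => [t|t1 t2 lt12 b1 b2].
    rewrite /col; case: eqP => [<- _|ne]; first by rewrite ltnS Nk.
    case/orP => [bt|/and3P[_ /eqP //]].
    by rewrite ltnS; apply: leq_trans (Nk t d); exact: (@rank_used n x b t t d (leqnn t) bt (ltn_ord (w t))).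
  rewrite -/(x t1) -/(x t2) leqNgt => e12; apply/negP => lt21; move: e12.
  have hN : N t2.+1 (x t2) <= N t1.+1 (x t2) by apply: rank_anti; lia.
  have := rank_le_id x b t1.+1 (x t1); have := rank_le_id x b t2.+1 (x t2).
  have := rank_mono x b t1.+1 (ltnW lt21).
  rewrite -/(N _ _) -/(N _ _) -/(N _ _) /col.
  case: eqP => e1; case: eqP => e2; try lia.
  have b2' : b t2 by case/orP: b2 => // /and3P[_ /eqP].
  by have := rank_used lt12 b2' lt21; rewrite -/(N _ _) -/(N _ _); lia.
have -> : [set t | b t || ex t] = [set t | b t] :|: [set t | ex t].
  by apply/setP => t; rewrite !inE.
rewrite cardsU (_ : _ :&: _ = set0) ?cards0; last first.
  by apply/setP => t; rewrite !inE /ex; case: (b t).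
have -> : [set u : 'I_n | (0 <= u) && ex u] = [set t | ex t] by apply/setP.
by rewrite subn0 -/b; lia.
Qed.

Lemma shRSK_le (i : 'I_d) : shRSK w i <= chain_state (codom w) (d.-1 - i).
Proof. by rewrite leq_subLR; apply: greene_succ_le. Qed.

Lemma shRSK_ge (i : 'I_d) : n <= shRSK w i + gap_state n (codom w) i.
Proof.
have h := greene_succ_ge (ltn_ord i); have g := gap_state_le n (codom w) i.
(* The subtraction in [shRSK] is truncated, so the Greene numbers must first be ordered; this
   follows from [gap_state <= n]. *)
have hG : greene i w <= greene i.+1 w.
  by rewrite -(leq_add2l n); apply: leq_trans h _; rewrite addnC leq_add2r.
by rewrite /shRSK -(leq_add2r (greene i w)) addnAC subnK.
Qed.

End Greene.

(** * Tail recursions and drifts *)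

Local Open Scope ring_scope.

Section Tail.
Variables (R : realFieldType) (rho : nat -> R).
Hypothesis rho01 : forall b, 0 <= rho b < 1.

Let rho_ge0 b : 0 <= rho b. Proof. by case/andP: (rho01 b). Qed.
Let rho_lt1 b : rho b < 1. Proof. by case/andP: (rho01 b). Qed.
Let rhoC_ge0 b : 0 <= 1 - rho b. Proof. by have := rho_lt1 b; lra. Qed.

(* tail l m y is the probability of X_m >= y, where X_0 = -oo,
   X_(b+1) = max (l b) X_b + H_b, and the H_b are independent geometric variables
   with P(H_b >= h) = rho b ^+ h; the recursion is the lack of memory of H_m. *)
Fixpoint tail (l : nat -> nat) (m : nat) : nat -> R :=
  if m is m'.+1 then
    fix tail_m y := if y is y'.+1 then
        if (y <= l m')%N then 1
        else (1 - rho m') * tail l m' y + rho m' * tail_m y'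
      else 1
  else fun=> 0.

Lemma tail1 l m y : (y <= l m)%N -> tail l m.+1 y = 1.
Proof. by case: y => //= y ->. Qed.

Lemma tailS l m y : (l m <= y)%N ->
  tail l m.+1 y.+1 = (1 - rho m) * tail l m y.+1 + rho m * tail l m.+1 y.
Proof. by move=> h /=; rewrite ltnNge h. Qed.

Arguments tail : simpl never.

Lemma tail_itv l m y : 0 <= tail l m y <= 1.
Proof.
elim: m y => [|m IHm] y; first by rewrite /tail lexx ler01.
elim: y => [|y IHy]; first by rewrite tail1 // lexx ler01.
have [h|h] := ltnP y (l m); first by rewrite tail1 // lexx ler01.
rewrite tailS //; have /andP[a0 a1] := IHm y.+1; have /andP[b0 b1] := IHy.
have := rho_ge0 m; have := rhoC_ge0 m; move: (rho m) => r r1 r0.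
apply/andP; split; first by rewrite addr_ge0 // mulr_ge0.
by have := ler_wpM2l r1 a1; have := ler_wpM2l r0 b1; lra.
Qed.

Lemma tail_ge0 l m y : 0 <= tail l m y. Proof. by case/andP: (tail_itv l m y). Qed.
Lemma tail_le1 l m y : tail l m y <= 1. Proof. by case/andP: (tail_itv l m y). Qed.

Lemma tail_mono l l' m y : (forall b, (b < m)%N -> (l b <= l' b)%N) ->
  tail l m y <= tail l' m y.
Proof.
elim: m y => [|m IHm] y hl; first by [].
elim: y => [|y IHy]; first by rewrite !tail1.
have [h|h] := ltnP y (l' m); first by rewrite (@tail1 l') // tail_le1.
have h' : (l m <= y)%N by apply: leq_trans h; apply: hl.
rewrite !tailS //; apply: lerD; apply: ler_wpM2l => //.
by apply: IHm => b hb; apply: hl; apply: leqW.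
Qed.

Lemma eq_tail l l' m y : (forall b, (b < m)%N -> l b = l' b) ->
  tail l m y = tail l' m y.
Proof.
move=> e; apply/eqP; rewrite eq_le !tail_mono // => b hb; by rewrite e.
Qed.

Lemma tail_shift l m y : tail (fun b => (l b).+1) m y.+1 = tail l m y.
Proof.
elim: m y => [|m IHm] y //.
elim: y => [|y IHy]; first by rewrite !tail1.
have [h|h] := ltnP y (l m); first by rewrite !tail1.
by rewrite [LHS]tailS // [RHS]tailS // IHm IHy.
Qed.

(** In units of the source rate, row [b] jumps at rate [rho b], and the right side is P(X_m = y):
    the glued value advances at rate at most 1. Above [l m] both sides follow the recursion [tailS],
    so the estimate propagates from the heights next to [l m]. *)
Lemma tail_up_drift l m y : (forall i j, (i <= j)%N -> (l i <= l j)%N) ->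
  \sum_(b < m) rho b * (tail (up_step b l) m y - tail l m y)
    <= tail l m y - tail l m y.+1.
Proof.
move=> lP; elim: m y => [|m IHm] y; first by rewrite big_ord0 subrr.
set A := fun y => \sum_(b < m) rho b * (tail (up_step b l) m.+1 y - tail l m.+1 y).
set A' := fun y => \sum_(b < m) rho b * (tail (up_step b l) m y - tail l m y).
set e := fun y => tail (up_step m l) m.+1 y - tail l m.+1 y.
rewrite big_ord_recr /= -/(A y) -/(e y).
have up_ge b j : (l j <= up_step b l j)%N by rewrite /up_step; case: ifP => // _; exact: leq_maxl.
have A0 z : (z <= l m)%N -> A z = 0.
  move=> hz; apply: big1 => b _; rewrite !tail1 ?subrr ?mulr0 //.
  exact: leq_trans (up_ge b m).
have e0 z : (z <= l m)%N -> e z = 0.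
  by move=> hz; rewrite /e !tail1 ?subrr //; apply: leq_trans (up_ge m m).
have AS z : (l m <= z)%N -> A z.+1 = (1 - rho m) * A' z.+1 + rho m * A z.
  move=> hz; rewrite /A /A' !mulr_sumr -big_split; apply: eq_bigr => b _ /=.
  rewrite (tailS hz); have [h|h] := leqP (up_step b l m) z.
    by rewrite (tailS h); ring.
  (* Row [b] pushes row [m] only if [l b = l m], and then it lifts row [m.-1] above [l m] too. *)
  have bm : (b <= m)%N by apply: ltnW.
  have lb := lP _ _ bm.
  have zl : z = l m by move: h; rewrite /up_step bm; lia.
  have hb : l b = l m by move: h; rewrite /up_step bm zl; lia.
  rewrite tail1 // (@tail1 l m z) ?zl // (@tail1 _ m (l m)) ?(up_ge b m) //.
  suff -> : tail (up_step b l) m (l m).+1 = 1 by ring.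
  have [m' em] : exists m', m = m'.+1 by exists m.-1; have := ltn_ord b; lia.
  have -> : tail (up_step b l) m = tail (up_step b l) m'.+1 by rewrite -em.
  apply: tail1; rewrite /up_step ifT; last by have := ltn_ord b; lia.
  by rewrite -hb leq_maxr.
have eS z : (l m < z)%N -> e z.+1 = rho m * e z.
  move=> hz; rewrite /e (tailS (ltnW hz)) tailS; last first.
    by rewrite /up_step leqnn geq_max hz (ltnW hz).
  rewrite (@eq_tail (up_step m l) l m); first by ring.
  by move=> b hb; rewrite /up_step leqNgt hb.
have [h|h] := leqP y (l m).
  by rewrite A0 // e0 // mulr0 addr0 (tail1 h) subr_ge0 tail_le1.
have {h} [z [-> ]] : exists z, y = (l m + z).+1.
  by exists (y - (l m).+1)%N; lia.
elim: z => [|z IHz].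
  have ez : e (l m + 0).+1 = 1 - tail l m.+1 (l m).+1.
    by rewrite /e addn0 tail1 // /up_step leqnn; lia.
  rewrite AS ?leq_addr // ez A0 ?addn0 // tailS // (@tailS l m (l m).+1) //.
  rewrite (tailS (leqnn _)) (@tail1 l m (l m)) //.
  by have := ler_wpM2l (rhoC_ge0 m) (IHm (l m).+1); rewrite -/(A' _); lra.
rewrite addnS AS; last by lia.
rewrite eS; last by lia.
rewrite (@tailS l m (l m + z).+1); last by lia.
rewrite (@tailS l m (l m + z).+2); last by lia.
have := ler_wpM2l (rhoC_ge0 m) (IHm (l m + z).+2); rewrite -/(A' _).
by have := ler_wpM2l (rho_ge0 m) IHz; lra.
Qed.

(** The balance [r b * rho b = beta] says that row [b] attempts jumps at rate [r b] and finds a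
    nonempty geometric gap with probability [rho b], so every row moves at rate [beta] in
    equilibrium. The proof is again by [tailS], from height [l m] upwards. *)
Lemma tail_down_drift (beta : R) (r : nat -> R) l m y :
  0 <= beta -> (forall b, (b < m)%N -> 0 <= r b) ->
  (forall b, (b < m)%N -> r b * rho b = beta) ->
  (0 < l 0)%N -> (forall i j, (i <= j)%N -> (l i <= l j)%N) ->
  \sum_(b < m) r b * (tail (down_step b l) m y.+1 - tail l m y.+1)
    <= - beta * (tail l m y - tail l m y.+1).
Proof.
move=> beta0 r0 rb l0 lP; elim: m y r0 rb => [|m IHm] y r0 rb.
  by rewrite big_ord0 subrr mulr0.
have {}IHm z := IHm z (fun b hb => r0 b (leqW hb)) (fun b hb => rb b (leqW hb)).
set A := fun y => \sum_(b < m) r b * (tail (down_step b l) m.+1 y - tail l m.+1 y).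
set A' := fun y => \sum_(b < m) r b * (tail (down_step b l) m y - tail l m y).
set e := fun y => tail (down_step m l) m.+1 y - tail l m.+1 y.
rewrite big_ord_recr /= -/(A y.+1) -/(e y.+1).
have dm b : (b < m)%N -> down_step b l m = l m.
  by move=> hb; rewrite /down_step; case: eqP => //; lia.
have lm0 : (0 < l m)%N by apply: leq_trans l0 _; apply: lP.
have A0 z : (z <= l m)%N -> A z = 0.
  by move=> hz; apply: big1 => b _; rewrite !tail1 ?subrr ?mulr0 ?dm.
have AS z : (l m <= z)%N -> A z.+1 = (1 - rho m) * A' z.+1 + rho m * A z.
  move=> hz; rewrite /A /A' !mulr_sumr -big_split; apply: eq_bigr => b _ /=.
  by rewrite (tailS hz) tailS ?dm //; ring.
have tm z : tail (down_step m l) m z = tail l m z.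
  by apply: eq_tail => b hb; rewrite /down_step ltn_eqF.
have eS z : (l m <= z)%N -> e z.+1 = rho m * e z.
  move=> hz; rewrite /e (tailS hz) tailS ?tm; first by ring.
  by apply: leq_trans hz; apply: down_step_le.
(* Either row [m] really falls, or row [m.-1] blocks it at the same height and [tail l m (l m)] is
   already 1; the formula covers both cases. *)
have el : e (l m) = (1 - rho m) * (tail l m (l m) - 1).
  rewrite /e (@tail1 l) //.
  have [h|h] := ltnP (down_step m l m) (l m).
    have [u hu] : exists u, l m = u.+1 by exists (l m).-1; lia.
    have hd : down_step m l m = u by have := down_step_ge l m m; lia.
    by rewrite hu tailS ?hd // tm tail1 ?hd //; ring.
  rewrite tail1 // subrr.
  suff -> : tail l m (l m) = 1 by ring.
  have [m' em] : exists m', m = m'.+1.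
    by exists m.-1; move: h l0; rewrite /down_step eqxx; case: (m); lia.
  have -> : tail l m = tail l m'.+1 by rewrite -em.
  by apply: tail1; move: h; rewrite /down_step eqxx em; lia.
have rm := rb m (ltnSn m).
have r0m := r0 m (ltnSn m).
have [h|h] := ltnP y (l m).
  rewrite A0 // add0r !tail1 ?(ltnW h) // subrr mulr0.
  by rewrite mulr_ge0_le0 // /e (tail1 h) subr_le0 tail_le1.
have {h} [z ->] : exists z, y = (l m + z)%N.
  by exists (y - l m)%N; lia.
elim: z => [|z IHz].
  rewrite addn0 AS // eS // A0 // el tailS // (@tail1 l m (l m)) //.
  have := ler_wpM2l (rhoC_ge0 m) (IHm (l m)); rewrite -/(A' _).
  move: (A' _) (tail _ _ _) (tail _ _ _) => a p q; rewrite -rm; lra.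
rewrite addnS AS; last by lia.
rewrite eS; last by lia.
rewrite (@tailS l m (l m + z).+1); last by lia.
have := ler_wpM2l (rhoC_ge0 m) (IHm (l m + z).+1); rewrite -/(A' _).
have := ler_wpM2l (rho_ge0 m) IHz; rewrite (@tailS l m (l m + z)); last by lia.
lra.
Qed.


(** * Means of the glued last-passage value *)

Lemma sum_ord_widen m M (F : nat -> R) : (m <= M)%N ->
  (forall b, (m <= b)%N -> F b = 0) -> \sum_(b < M) F b = \sum_(b < m) F b.
Proof.
move=> mM F0; rewrite -(big_mkord xpredT F) -(big_mkord xpredT F).
rewrite (@big_cat_nat _ _ _ m) //= [X in _ + X]big_nat_cond [X in _ + X]big1 ?addr0 //.
by move=> b /andP[/andP[h _] _]; apply: F0.
Qed.

(* The mean of min X_m K; full_mean below is the mean of X_m. *)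
Definition trunc_mean (l : nat -> nat) (m K : nat) : R := \sum_(y < K) tail l m y.+1.

Lemma trunc_mean_ge l m K : (l m <= K)%N -> (l m)%:R <= trunc_mean l m.+1 K.
Proof.
move=> lK; rewrite /trunc_mean.
rewrite -(big_mkord xpredT (fun y => tail l m.+1 y.+1)) (@big_cat_nat _ _ _ (l m)) //=.
rewrite -[X in X <= _]addr0; apply: lerD; last by apply: sumr_ge0 => y _; apply: tail_ge0.
rewrite big_mkord (eq_bigr (fun=> 1)) ?sumr_const ?card_ord //.
by move=> y _; rewrite tail1.
Qed.

(** From the zero state X_m is a sum of independent geometric variables with means
    [rho b / (1 - rho b)]. *)
Lemma trunc_mean0 m K :
  trunc_mean (fun=> 0%N) m K <= \sum_(b < m) rho b / (1 - rho b).
Proof.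
elim: m => [|m IH]; first by rewrite big_ord0 /trunc_mean big1.
rewrite big_ord_recr /=; set l := fun=> 0%N; set S := trunc_mean l m.+1 K.
have r1 : 0 < 1 - rho m by rewrite subr_gt0.
have le1 : \sum_(y < K) tail l m.+1 y <= 1 + S.
  case: K @S {IH} => [|K] S; first by rewrite big_ord0 addr_ge0 ?sumr_ge0 // => y _; apply: tail_ge0.
  rewrite big_ord_recl tail1 // lerD2l /S /trunc_mean big_ord_recr /= lerDl; exact: tail_ge0.
have eS : S = (1 - rho m) * trunc_mean l m K + rho m * \sum_(y < K) tail l m.+1 y.
  rewrite /S /trunc_mean !mulr_sumr -big_split; apply: eq_bigr => y _ /=.
  by rewrite tailS.
rewrite -(ler_pM2l r1) mulrDr mulrCA divff ?gt_eqF // mulr1.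
have := ler_wpM2l (ltW r1) IH; have := ler_wpM2l (rho_ge0 m) le1.
by lra.
Qed.

Lemma trunc_mean_mono l l' m K : (forall b, (b < m)%N -> (l b <= l' b)%N) ->
  trunc_mean l m K <= trunc_mean l' m K.
Proof. by move=> h; apply: ler_sum => y _; apply: tail_mono. Qed.

Lemma trunc_meanS l l' m K : (forall b, (b < m)%N -> (l' b <= (l b).+1)%N) ->
  trunc_mean l' m K <= 1 - tail l m K + trunc_mean l m K.
Proof.
move=> h; apply: (@le_trans _ _ (\sum_(y < K) tail l m y)).
  by apply: ler_sum => y _; rewrite -(tail_shift l); apply: tail_mono.
case: K => [|K]; first by rewrite /trunc_mean !big_ord0 addr0 subr_ge0 tail_le1.
rewrite /trunc_mean big_ord_recl [in leRHS]big_ord_recr /=.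
by have := tail_le1 l m 0; lra.
Qed.

Lemma trunc_mean_up_drift l m K : (forall i j, (i <= j)%N -> (l i <= l j)%N) ->
  \sum_(b < m) rho b * (trunc_mean (up_step b l) m K - trunc_mean l m K) <= 1.
Proof.
move=> lP.
rewrite (eq_bigr (fun b : 'I_m => \sum_(y < K)
   rho b * (tail (up_step b l) m y.+1 - tail l m y.+1))); last first.
  by move=> b _; rewrite -mulr_sumr -sumrB.
rewrite exchange_big /=.
apply: (@le_trans _ _ (\sum_(y < K) (tail l m y.+1 - tail l m y.+2))).
  by apply: ler_sum => y _; apply: tail_up_drift.
rewrite -(big_mkord xpredT (fun y => tail l m y.+1 - tail l m y.+2)).
rewrite (telescope_sumr_eq (fun y => - tail l m y.+1)) // => [|y _]; last by ring.
by have := tail_le1 l m 1; have := tail_ge0 l m K.+1; lra.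
Qed.

(* The sum over [b] accounts exactly for the part of the mean cut off at height
   [K.+1], so that the drift estimate loses nothing to the truncation. *)
Definition full_mean (l : nat -> nat) (m K : nat) : R :=
  trunc_mean l m K.+1 + \sum_(b < m) rho b / (1 - rho b) * tail l b.+1 K.+1.

Let odds_ge0 b : 0 <= rho b / (1 - rho b).
Proof. exact: divr_ge0. Qed.

(** Solving [tailS] for the odds makes the correction terms of [full_mean] telescope in [b]. *)
Lemma tail_odds l b y : (l b <= y)%N ->
  rho b / (1 - rho b) * (tail l b.+1 y - tail l b.+1 y.+1) =
  tail l b.+1 y.+1 - tail l b y.+1.
Proof.
have r1 : 1 - rho b != 0 by rewrite gt_eqF // subr_gt0.
by move=> h; rewrite (tailS h); field.
Qed.

Lemma tail_telescope l m y :
  \sum_(b < m) (tail l b.+1 y - tail l b y) = tail l m y.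
Proof.
rewrite -(big_mkord xpredT (fun b => tail l b.+1 y - tail l b y)).
by rewrite (telescope_sumr_eq (fun b => tail l b y)) //= subr0.
Qed.

Lemma full_mean_ge l m K : (l m <= K)%N -> (l m)%:R <= full_mean l m.+1 K.
Proof.
move=> h; apply: le_trans (trunc_mean_ge (leqW h)) _; rewrite lerDl.
by apply: sumr_ge0 => b _; rewrite mulr_ge0 // tail_ge0.
Qed.

Lemma full_mean_const m K :
  full_mean (fun=> K) m.+1 K = K%:R + \sum_(b < m.+1) rho b / (1 - rho b).
Proof.
set l := fun=> K; rewrite /full_mean.
have -> : trunc_mean l m.+1 K.+1 = K%:R + tail l m.+1 K.+1.
  rewrite /trunc_mean big_ord_recr /=; congr (_ + _).
  rewrite (eq_bigr (fun=> 1)) ?sumr_const ?card_ord //.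
  by move=> y _; rewrite tail1.
rewrite -addrA; congr (_ + _); rewrite -{1}(tail_telescope l m.+1 K.+1) -big_split /=.
apply: eq_bigr => b _; rewrite -tail_odds // tail1 //; ring.
Qed.

Lemma full_mean_mono l l' m K : (forall b, (b < m)%N -> (l b <= l' b)%N) ->
  full_mean l m K <= full_mean l' m K.
Proof.
move=> h; apply: lerD; first exact: trunc_mean_mono.
apply: ler_sum => b _; apply: ler_wpM2l => //; apply: tail_mono => c hc.
by apply: h; have := ltn_ord b; lia.
Qed.

Lemma full_meanS l l' m K : (forall b, (b < m)%N -> (l b <= K)%N) ->
  (forall b, (b < m)%N -> (l' b <= (l b).+1)%N) ->
  full_mean l' m K <= 1 + full_mean l m K.
Proof.
move=> lK h; rewrite /full_mean.
have h1 := trunc_meanS K.+1 h.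
suff h2 : \sum_(b < m) rho b / (1 - rho b) * tail l' b.+1 K.+1 <=
    tail l m K.+1 + \sum_(b < m) rho b / (1 - rho b) * tail l b.+1 K.+1 by lra.
rewrite -{1}(tail_telescope l m K.+1) -big_split /=.
apply: ler_sum => b _; rewrite -tail_odds ?lK // -mulrDr subrK.
apply: ler_wpM2l => //; rewrite -(tail_shift l); apply: tail_mono => c hc.
by apply: h; have := ltn_ord b; lia.
Qed.

Lemma full_mean_down_drift (beta : R) (r : nat -> R) l m K :
  (0 < m)%N -> 0 <= beta -> (forall b, (b < m)%N -> 0 <= r b) ->
  (forall b, (b < m)%N -> r b * rho b = beta) ->
  (0 < l 0)%N -> (forall i j, (i <= j)%N -> (l i <= l j)%N) ->
  (forall b, (b < m)%N -> (l b <= K)%N) ->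
  \sum_(b < m) r b * (full_mean (down_step b l) m K - full_mean l m K) <= - beta.
Proof.
move=> m0 beta0 r0 rb l0 lP lK.
pose D b j y := r b * (tail (down_step b l) j y - tail l j y).
rewrite (eq_bigr (fun b : 'I_m => \sum_(y < K.+1) D b m y.+1 +
   \sum_(j < m) rho j / (1 - rho j) * D b j.+1 K.+1)); last first.
  move=> b _; rewrite /full_mean /D opprD addrACA mulrDr; congr (_ + _).
    by rewrite -mulr_sumr sumrB.
  rewrite -sumrB mulr_sumr; apply: eq_bigr => j _; ring.
rewrite big_split /= exchange_big /= [X in _ + X]exchange_big /=.
(* The truncated mean only yields [beta] times P(X_m <= K); the correction terms supply the missing
   [beta * tail l m K.+1]. *)
have h1 : \sum_(y < K.+1) \sum_(b < m) D b m y.+1 <= - beta * (1 - tail l m K.+1).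
  apply: (@le_trans _ _ (\sum_(y < K.+1) - beta * (tail l m y - tail l m y.+1))).
    by apply: ler_sum => y _; apply: tail_down_drift.
  rewrite -mulr_sumr -(big_mkord xpredT (fun y => tail l m y - tail l m y.+1)).
  rewrite (telescope_sumr_eq (fun y => - tail l m y)) // => [|y _]; last by ring.
  by case: m m0 {r0 rb lK D} => // m _; rewrite (@tail1 l m 0) // opprK addrC.
have h2 : \sum_(j < m) \sum_(b < m) rho j / (1 - rho j) * D b j.+1 K.+1
    <= - beta * tail l m K.+1.
  rewrite -[in leRHS]tail_telescope mulr_sumr; apply: ler_sum => j _.
  rewrite -mulr_sumr (sum_ord_widen (F := fun b => D b j.+1 K.+1) (ltn_ord j)); last first.
    move=> b hb; rewrite /D (@eq_tail _ l j.+1) ?subrr ?mulr0 // => c hc.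
    by rewrite /down_step ltn_eqF //; lia.
  rewrite -tail_odds ?lK // mulrCA; apply: ler_wpM2l => //.
  by apply: tail_down_drift => // b hb; [apply: r0 | apply: rb]; have := ltn_ord j; lia.
by apply: le_trans (lerD h1 h2) _; lra.
Qed.

End Tail.

(** * Second moments of one-sided deviations *)

Section PositivePart.
Variable R : realFieldType.
Implicit Types x y c t : R.

Definition sqr_pos x : R := (Num.max 0 x) ^+ 2.

Lemma sqr_pos_le x c : 0 <= c -> x <= c -> sqr_pos x <= c ^+ 2.
Proof.
move=> c0 xc; rewrite /sqr_pos ler_sqr ?nnegrE ?le_max ?lexx //.
by rewrite ge_max c0 xc.
Qed.

Lemma sqr_pos_mono x y : x <= y -> sqr_pos x <= sqr_pos y.
Proof.
by move=> xy; apply: sqr_pos_le; rewrite ?le_max ?lexx // xy orbT.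
Qed.

Lemma sqr_pos_le_sqr x : sqr_pos x <= x ^+ 2.
Proof. by rewrite -(real_normK (num_real x)); apply: sqr_pos_le; rewrite ?ler_norm. Qed.

Lemma sqr_le_pos x : x ^+ 2 <= sqr_pos x + sqr_pos (- x).
Proof.
rewrite /sqr_pos; have [x0|x0] := leP 0 x.
  by rewrite lerDl sqr_ge0.
by rewrite (max_r _) ?sqrrN ?lerDr ?sqr_ge0 // oppr_ge0 ltW.
Qed.

Lemma sqr_pos_addl x c : 0 <= c -> sqr_pos (x + c) <= 2 * sqr_pos x + 2 * c ^+ 2.
Proof.
move=> c0; have p0 : 0 <= Num.max 0 x by rewrite le_max lexx.
have px : x <= Num.max 0 x by rewrite le_max lexx orbT.
apply: (le_trans (sqr_pos_le (c := Num.max 0 x + c) _ _)); [lra|lra|].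
rewrite /sqr_pos; move: (Num.max 0 x) => p.
by have := sqr_ge0 (p - c); lra.
Qed.

Lemma sqr_pos_convex x t : 0 <= t <= 1 ->
  sqr_pos (x + t) <= (1 - t) * sqr_pos x + t * sqr_pos (x + 1).
Proof.
move=> /andP[t0 t1].
have p0 : 0 <= Num.max 0 x by rewrite le_max lexx.
have px : x <= Num.max 0 x by rewrite le_max lexx orbT.
have q0 : 0 <= Num.max 0 (x + 1) by rewrite le_max lexx.
have qx : x + 1 <= Num.max 0 (x + 1) by rewrite le_max lexx orbT.
rewrite {2 3}/sqr_pos; move: (Num.max 0 x) (Num.max 0 (x + 1)) p0 px q0 qx => p q p0 px q0 qx.
have t1' : 0 <= 1 - t by rewrite subr_ge0.
apply: (le_trans (sqr_pos_le (c := (1 - t) * p + t * q) _ _)).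
- by rewrite addr_ge0 ?mulr_ge0.
- by have := ler_wpM2l t1' px; have := ler_wpM2l t0 qx; lra.
- by have := mulr_ge0 (mulr_ge0 t0 t1') (sqr_ge0 (p - q)); lra.
Qed.

End PositivePart.

(** * Expectation over words and the martingale bound *)

Section Expectation.
Variables (R : realFieldType) (d : nat) (alpha : 'I_d -> R).
Hypothesis alpha_ge0 : forall a, 0 <= alpha a.
Hypothesis alpha_sum : \sum_(a < d) alpha a = 1.

(** The word is built from its end, as the states read it, so the inner sum is the conditional mean
    given the suffix [s]. *)
Fixpoint expect (n : nat) (F : seq 'I_d -> R) : R :=
  if n is n'.+1 then expect n' (fun s => \sum_a alpha a * F (a :: s)) else F [::].

Lemma eq_expect n F G : F =1 G -> expect n F = expect n G.
Proof.
elim: n F G => [|n IH] F G e /=; first exact: e.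
by apply: IH => s; apply: eq_bigr => a _; rewrite e.
Qed.

Lemma expect_words n (F : seq 'I_d -> R) :
  \sum_(w : {ffun 'I_n -> 'I_d}) (\prod_t alpha (w t)) * F (codom w) = expect n F.
Proof.
elim: n F => [|n IH] F /=.
  have e0 (w : {ffun 'I_0 -> 'I_d}) : codom w = [::].
    by apply: size0nil; rewrite size_codom card_ord.
  rewrite (eq_bigr (fun=> F [::])) => [|w _]; last by rewrite big_ord0 mul1r e0.
  by rewrite sumr_const card_ffun !card_ord expn0.
rewrite -IH.
pose cons_word (p : 'I_d * {ffun 'I_n -> 'I_d}) : {ffun 'I_n.+1 -> 'I_d} :=
  [ffun t => if unlift ord0 t is Some u then p.2 u else p.1].
rewrite (reindex cons_word) /=; last first.
  exists (fun w : {ffun 'I_n.+1 -> 'I_d} => (w ord0, [ffun u => w (lift ord0 u)])).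
    move=> [a w] _; rewrite /cons_word /= ffunE unlift_none; congr (_, _).
    by apply/ffunP => u; rewrite !ffunE liftK.
  move=> w _; apply/ffunP => t; rewrite /cons_word ffunE.
  by case: unliftP => [u ->|->] //=; rewrite ffunE.
have e1 a w : cons_word (a, w) ord0 = a by rewrite ffunE unlift_none.
have e2 a w u : cons_word (a, w) (lift ord0 u) = w u by rewrite ffunE liftK.
have e3 a w : codom (cons_word (a, w)) = a :: codom w.
  rewrite !codomE enum_ordSl /= e1 -map_comp; congr (_ :: _).
  by apply: eq_map => u /=; rewrite e2.
rewrite -(pair_bigA _ (fun a w => \prod_t alpha (cons_word (a, w) t) *
   F (codom (cons_word (a, w))))) /= exchange_big /=.
apply: eq_bigr => w _; rewrite mulr_sumr; apply: eq_bigr => a _.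
rewrite e3 big_ord_recl e1 (eq_bigr (fun t => alpha (w t))) => [|t _]; last by rewrite e2.
by rewrite mulrCA mulrA.
Qed.

Lemma ler_expect n (F G : seq 'I_d -> R) :
  (forall s, size s = n -> F s <= G s) -> expect n F <= expect n G.
Proof.
elim: n F G => [|n IH] F G h /=; first exact: h.
apply: IH => s es; apply: ler_sum => a _; apply: ler_wpM2l => //.
by apply: h; rewrite /= es.
Qed.

Lemma expectD n (F G : seq 'I_d -> R) :
  expect n (fun s => F s + G s) = expect n F + expect n G.
Proof.
elim: n F G => [|n IH] F G //=; rewrite -IH; apply: eq_expect => s.
by rewrite -big_split; apply: eq_bigr => a _; rewrite mulrDr.
Qed.

Lemma expectZ n c (F : seq 'I_d -> R) : expect n (fun s => c * F s) = c * expect n F.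
Proof.
elim: n F => [|n IH] F //=; rewrite -IH; apply: eq_expect => s.
by rewrite mulr_sumr; apply: eq_bigr => a _; rewrite mulrCA.
Qed.

Lemma expect_cst n c : expect n (fun=> c) = c.
Proof.
elim: n => [|n IH] //=; rewrite -[RHS]IH; apply: eq_expect => s.
by rewrite -mulr_suml alpha_sum mul1r.
Qed.

(* By convexity the worst increment is a Bernoulli variable of mean beta,
   whose variance is beta * (1 - beta). *)
Lemma sqr_pos_increment (y beta v : R) (D : 'I_d -> R) :
  0 <= beta -> 0 <= v -> beta * (1 - beta) <= v ->
  (forall a, 0 <= D a <= 1) -> \sum_a alpha a * D a <= beta ->
  \sum_a alpha a * sqr_pos (y + D a - beta) <= sqr_pos y + v.
Proof.
move=> b0 v0 bv D01 Db.
set p := Num.max 0 y.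
have p0 : 0 <= p by rewrite le_max lexx.
have py : y <= p by rewrite le_max lexx orbT.
(* [beta] may exceed 1, as when letters are counted at rate [d * alpha i]; the compensated
   increments are then nonpositive. *)
have [b1|b1] := leP beta 1; last first.
  apply: (@le_trans _ _ (sqr_pos y)); last by rewrite lerDl.
  rewrite -[leRHS]mul1r -alpha_sum mulr_suml; apply: ler_sum => a _.
  apply: ler_wpM2l => //; apply: sqr_pos_mono.
  by have /andP[_] := D01 a; lra.
set A := sqr_pos (y - beta); set B := sqr_pos (y - beta + 1).
have AB : A <= B by apply: sqr_pos_mono; rewrite lerDl ler01.
have -> : sqr_pos y = p ^+ 2 by [].
apply: (@le_trans _ _ (\sum_a (alpha a * A + alpha a * D a * (B - A)))).
  apply: ler_sum => a _; have := sqr_pos_convex (y - beta) (D01 a).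
  rewrite -/A -/B addrAC => h.
  by apply: (le_trans (ler_wpM2l (alpha_ge0 a) h)); lra.
rewrite big_split /= -!mulr_suml alpha_sum mul1r.
have h1 : \sum_a alpha a * D a * (B - A) = (\sum_a alpha a * D a) * (B - A).
  by rewrite mulr_suml.
have h2 : (\sum_a alpha a * D a) * (B - A) <= beta * (B - A).
  by apply: ler_wpM2r => //; rewrite subr_ge0.
have hA : A <= (p - beta) ^+ 2.
  by apply: le_trans (sqr_pos_le_sqr _); apply: sqr_pos_mono; lra.
have hB : B <= (p - beta + 1) ^+ 2.
  by apply: le_trans (sqr_pos_le_sqr _); apply: sqr_pos_mono; lra.
have b1' : 0 <= 1 - beta by rewrite subr_ge0.
(* The Bernoulli average of the two squares is exactly [p ^+ 2 + beta * (1 - beta)]. *)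
have := ler_wpM2l b1' hA; have := ler_wpM2l b0 hB; lra.
Qed.

(** Each letter adds at most [v], by [sqr_pos_increment]. As the drift is bounded on one side only,
    only the positive part is controlled. *)
Lemma expect_sqr_pos n (X : seq 'I_d -> R) (beta v : R) :
  0 <= beta -> 0 <= v -> beta * (1 - beta) <= v ->
  (forall s a, (size s < n)%N -> 0 <= X (a :: s) - X s <= 1) ->
  (forall s, (size s < n)%N -> \sum_a alpha a * (X (a :: s) - X s) <= beta) ->
  expect n (fun s => sqr_pos (X s - X [::] - n%:R * beta)) <= n%:R * v.
Proof.
move=> b0 v0 bv; elim: n => [|n IH] X01 Xb.
  by rewrite /= !mul0r !subr0 subrr /sqr_pos maxxx expr0n.
have {}IH := IH (fun s a h => X01 s a (leqW h)) (fun s h => Xb s (leqW h)).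
have -> : n.+1%:R * v = n%:R * v + v by rewrite -natr1; ring.
apply: le_trans (lerD IH (lexx v)).
rewrite -[X in _ + X](expect_cst n v) -expectD; apply: (@ler_expect n) => s es.
have hs : (size s < n.+1)%N by rewrite es.
have := sqr_pos_increment (X s - X [::] - n%:R * beta) b0 v0 bv (fun a => X01 s a hs) (Xb s hs).
move=> h; apply: le_trans h; apply: ler_sum => a _; apply: ler_wpM2l => //.
by apply: sqr_pos_mono; rewrite -natr1; lra.
Qed.

End Expectation.

(** * Rows of the RSK shape *)

Lemma rev_ord_le d (a i : 'I_d) : (d.-1 - a <= d.-1 - i)%N = (i <= a)%N.
Proof. by have := ltn_ord a; have := ltn_ord i; lia. Qed.

Lemma rev_rev_ord d (a : 'I_d) : (d.-1 - (d.-1 - a) = a)%N.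
Proof. by have := ltn_ord a; lia. Qed.

Lemma val_rev_ord d (a : 'I_d) : rev_ord a = (d.-1 - a)%N :> nat.
Proof. by rewrite /=; lia. Qed.

Section Row.
Variables (R : rcfType) (d n : nat) (alpha : 'I_d -> R) (i : 'I_d).
Hypothesis alpha_ge0 : forall a, 0 <= alpha a.
Hypothesis alpha_sum : \sum_(a < d) alpha a = 1.
Hypothesis alpha_mono : forall a b : 'I_d, (a <= b)%N -> alpha b <= alpha a.
Hypothesis alpha_gt0 : 0 < alpha i.
Hypothesis n_gt0 : (0 < n)%N.

Let al (b : nat) : R := oapp alpha 0 (insub b).
Let dR : R := d%:R.
Let nR : R := n%:R.
Let s2 : R := dR * alpha i * nR.
Let s : R := Num.sqrt s2.

Let alE (a : 'I_d) : al a = alpha a. Proof. by rewrite /al valK. Qed.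
Let al_ge0 b : 0 <= al b. Proof. by rewrite /al; case: insub => /=. Qed.
Let d_gt0 : (0 < d)%N. Proof. exact: leq_ltn_trans (leq0n i) (ltn_ord i). Qed.
Let dR_ge1 : 1 <= dR. Proof. by rewrite ler1n. Qed.
Let nR_gt0 : 0 < nR. Proof. by rewrite ltr0n. Qed.
Let s2_gt0 : 0 < s2. Proof. by rewrite !mulr_gt0 // ltr0n. Qed.
Let s_gt0 : 0 < s. Proof. by rewrite sqrtr_gt0. Qed.
Let sqr_s : s * s = s2. Proof. by rewrite -expr2 sqr_sqrtr // ltW. Qed.
Let an_le : alpha i * nR <= s2.
Proof.
rewrite /s2 -mulrA -[leLHS]mul1r; apply: ler_wpM2r => //.
by rewrite mulr_ge0 // ltW.
Qed.
Let alpha_le1 : alpha i <= 1.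
Proof. by rewrite -alpha_sum (bigD1 i) //= lerDl sumr_ge0. Qed.

Let al_le b : (i <= b)%N -> al b <= alpha i.
Proof.
move=> ib; rewrite /al; case: insubP => /= [a _ ea|_]; last exact: ltW.
by apply: alpha_mono; rewrite ea.
Qed.

Let al_ge b : (b <= i)%N -> alpha i <= al b.
Proof.
move=> bi; rewrite /al; case: insubP => /= [a _ ea|]; first by apply: alpha_mono; rewrite ea.
by rewrite (leq_ltn_trans bi (ltn_ord i)).
Qed.

(** Transfers the bound from the Lyapunov function [X] to [F]; [c] absorbs the initial value and the
    shift of the rate. *)
Lemma expect_shift (F X : seq 'I_d -> R) (beta v c : R) :
  0 <= beta -> 0 <= v -> beta * (1 - beta) <= v -> 0 <= c ->
  (forall w a, (size w < n)%N -> 0 <= X (a :: w) - X w <= 1) ->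
  (forall w, (size w < n)%N -> \sum_a alpha a * (X (a :: w) - X w) <= beta) ->
  (forall w, size w = n -> F w <= X w - X [::] - nR * beta + c) ->
  expect alpha n (fun w => sqr_pos (F w)) <= 2 * (nR * v) + 2 * c ^+ 2.
Proof.
move=> b0 v0 bv c0 X01 Xb FX.
have h := expect_sqr_pos alpha_ge0 alpha_sum b0 v0 bv X01 Xb.
apply: (@le_trans _ _ (expect alpha n (fun w =>
    2 * sqr_pos (X w - X [::] - nR * beta) + 2 * c ^+ 2))).
  apply: ler_expect => // w ew; apply: le_trans (sqr_pos_addl _ c0).
  exact/sqr_pos_mono/FX.
rewrite expectD expectZ expect_cst // lerD2r.
by apply: ler_wpM2l h.
Qed.

Let m := (d.-1 - i).+1.
Let C (w : seq 'I_d) : R := (chain_state w (d.-1 - i))%:R.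

Let md : (m <= d)%N. Proof. by rewrite /m; lia. Qed.

(** Here [s] may exceed [s2], so the shifted rate is too costly. Counting all letters at least [i]
    suffices: the count has mean at most [s2], and [s2 ^+ 2 <= s2]. *)
Lemma chain_upper_small : s2 < 1 ->
  expect alpha n (fun w => sqr_pos (C w - alpha i * nR)) <= 4 * s2.
Proof.
move=> s21; pose q (a : 'I_d) := (d.-1 - a <= d.-1 - i)%N.
pose X (w : seq 'I_d) : R := (count q w)%:R.
have eX w a : X (a :: w) - X w = (q a)%:R by rewrite /X /= natrD addrK.
have b0 : 0 <= dR * alpha i by rewrite mulr_ge0 // ltW // ltr0n.
have h := @expect_shift (fun w => C w - alpha i * nR) X (dR * alpha i) (dR * alpha i) s2
  b0 b0 _ (ltW s2_gt0) _ _ _.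
apply: (le_trans (h _ _ _ _)).
- by have := mulr_ge0 b0 b0; lra.
- by move=> w a _; rewrite eX; case: (q a); rewrite ?lexx ?ler01.
- move=> w _; rewrite /dR mulr_natl -[in leRHS](card_ord d) -sumr_const.
  apply: ler_sum => a _; rewrite eX /q; case: leqP => h'; last by rewrite mulr0 ltW.
  by rewrite mulr1; apply: alpha_mono; rewrite -rev_ord_le.
- move=> w ew; rewrite /X /= subr0.
  have : C w <= (count q w)%:R by rewrite ler_nat; apply: chain_state_le_count.
  have := mulr_ge0 (ltW alpha_gt0) (ltW nR_gt0).
  have -> : nR * (dR * alpha i) = s2 by rewrite /s2; ring.
  lra.
have -> : nR * (dR * alpha i) = s2 by rewrite /s2; ring.
by have := ler_wpM2l (ltW s2_gt0) (ltW s21); lra.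
Qed.

Lemma chain_upper_large : 1 <= s2 ->
  expect alpha n (fun w => sqr_pos (C w - alpha i * nR)) <= 12 * s2.
Proof.
move=> s21; pose delta := s / nR.
have de0 : 0 < delta by rewrite divr_gt0.
have nde : nR * delta = s by rewrite /delta mulrCA divff ?mulr1 // gt_eqF.
pose beta := alpha i + delta.
have be0 : 0 < beta by rewrite addr_gt0.
pose rho b := if (b < m)%N then al (d.-1 - b) / beta else 0.
have alm b : (b < m)%N -> al (d.-1 - b) <= alpha i.
  by move=> hb; apply: al_le; move: hb; rewrite /m; have := ltn_ord i; lia.
have rho01 b : 0 <= rho b < 1.
  rewrite /rho; case: ifP => hb; last by rewrite lexx ltr01.
  rewrite divr_ge0 // ?ltW //= ltr_pdivrMr // mul1r.
  by apply: le_lt_trans (alm b hb) _; rewrite /beta ltrDl.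
pose X (w : seq 'I_d) := trunc_mean rho (chain_state w) m n.
(* Each gap has mean at most [alpha i / delta], and [dR * alpha i / delta = s2 / s = s]; this
   balance explains the choice of [delta]. *)
have X0 : X [::] <= s.
  apply: le_trans (trunc_mean0 rho01 m n) _.
  apply: (@le_trans _ _ (\sum_(b < m) alpha i / delta)).
    apply: ler_sum => b _; rewrite /rho ltn_ord.
    have h := alm b (ltn_ord b); have h0 := al_ge0 (d.-1 - b).
    have hb : 0 < beta - al (d.-1 - b) by rewrite /beta; lra.
    have -> : al (d.-1 - b) / beta / (1 - al (d.-1 - b) / beta)
              = al (d.-1 - b) / (beta - al (d.-1 - b)).
      by field; rewrite !gt_eqF.
    rewrite ler_pdivrMr // mulrAC ler_pdivlMr //.
    by apply: ler_pM => //; [exact: ltW | rewrite /beta; lra].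
  rewrite sumr_const card_ord -mulr_natl mulrA ler_pdivrMr // /delta mulrA sqr_s /s2.
  rewrite mulfK ?gt_eqF //; apply: ler_wpM2r; [exact: ltW | by rewrite ler_nat].
(* One [s] pays for [X [::]], the other for the shift [nR * delta] of the rate. *)
have h := @expect_shift (fun w => C w - alpha i * nR) X beta beta (2 * s)
  (ltW be0) (ltW be0) _ _ _ _ _.
apply: (le_trans (h _ _ _ _ _)).
- by have := mulr_ge0 (ltW be0) (ltW be0); lra.
- by have := s_gt0; lra.
- move=> w a _; rewrite subr_ge0; apply/andP; split.
    apply: trunc_mean_mono => // b _.
    by rewrite /= [up_step _ _ _]/up_step; case: ifP => // _; exact: leq_maxl.
  rewrite lerBlDr; apply: (le_trans (@trunc_meanS _ _ rho01 (chain_state w) _ m n _)).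
    move=> b _; rewrite /= [up_step _ _ _]/up_step; case: ifP => // hb.
    by rewrite geq_max leqnSn /= ltnS; apply: chain_state_mono.
  by have := tail_ge0 rho01 (chain_state w) m n; rewrite /X; lra.
- move=> w _.
  pose G b := al (d.-1 - b) * (trunc_mean rho (up_step b (chain_state w)) m n - X w).
  have -> : \sum_a alpha a * (X (a :: w) - X w) = \sum_(b < d) G b.
    rewrite [RHS](reindex_inj rev_ord_inj); apply: eq_bigr => a _.
    by rewrite /G val_rev_ord rev_rev_ord alE.
  rewrite (sum_ord_widen md) => [|b hb]; last first.
    rewrite /G /X /trunc_mean -sumrB big1 ?mulr0 // => y _.
    rewrite (@eq_tail _ _ rho01 _ (chain_state w)) ?subrr // => c hc.
    by rewrite /up_step leqNgt (leq_trans hc hb).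
  have h1 := trunc_mean_up_drift rho01 m n (@chain_state_mono _ w).
  apply: le_trans (_ : beta * 1 <= beta); last by rewrite mulr1.
  apply: le_trans (ler_wpM2l (ltW be0) h1); rewrite mulr_sumr.
  apply: ler_sum => b _; rewrite /G /rho ltn_ord le_eqVlt; apply/orP; left; apply/eqP.
  by rewrite mulrA; congr (_ * _); rewrite mulrCA divff ?mulr1 // gt_eqF.
- move=> w ew.
  have hc : (chain_state w (d.-1 - i) <= n)%N.
    by apply: leq_trans (chain_state_le_count _ _) _; rewrite -ew count_size.
  have := trunc_mean_ge rho01 hc; rewrite -/(X w) -/(C w).
  by rewrite /beta; have := nde; have := X0; lra.
(* As [s <= s2], [nR * beta] is at most [2 * s2], which contributes [4 * s2]; the shift [2 * s]
   contributes [8 * s2]. *)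
have := an_le; have : s <= s2.
  rewrite -sqr_s -[leLHS]mulr1; apply: ler_wpM2l; first exact: ltW.
  by rewrite -[leLHS](@sqrtr1 R) ler_wsqrtr.
rewrite exprMn expr2 [s ^+ 2]expr2 sqr_s /beta mulrDr nde; lra.
Qed.

Let g (w : seq 'I_d) : R := (gap_state n w i)%:R.

Lemma gap_lower :
  expect alpha n (fun w => sqr_pos (alpha i * nR - (nR - g w))) <= 10 * s2.
Proof.
have gn w : g w <= nR by rewrite ler_nat; apply: gap_state_le.
(* In the small case the deviation is at most [alpha i * nR], whose square is at most [s2].
   Otherwise [s < alpha i * nR], so that [beta] below is positive. *)
have [small|large] := leP (alpha i * nR) dR.
  apply: (@le_trans _ _ s2); last by have := s2_gt0; lra.
  rewrite -[leRHS](expect_cst alpha_sum n); apply: ler_expect => // w _.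
  have an0 : 0 <= alpha i * nR by rewrite mulr_ge0 // ltW.
  apply: (le_trans (sqr_pos_le an0 _)); first by have := gn w; lra.
  by rewrite /s2 -mulrA expr2; apply: ler_wpM2r.
have s_lt : s < alpha i * nR.
  rewrite -[ltRHS]ger0_norm ?mulr_ge0 ?ltW // -sqrtr_sqr ltr_sqrt ?exprn_gt0 ?mulr_gt0 //.
  by rewrite expr2 /s2 -mulrA ltr_pM2r // mulr_gt0.
pose delta := s / nR.
have de0 : 0 < delta by rewrite divr_gt0.
have nde : nR * delta = s by rewrite /delta mulrCA divff ?mulr1 // gt_eqF.
pose beta := alpha i - delta.
have be0 : 0 < beta by rewrite subr_gt0 ltr_pdivrMr.
have be1 : beta <= 1 by rewrite /beta; have := alpha_le1; lra.
pose rho b := if (b < i.+1)%N then beta / al b else 0.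
have alm b : (b < i.+1)%N -> alpha i <= al b by rewrite ltnS; apply: al_ge.
have alm0 b : (b < i.+1)%N -> 0 < al b by move=> hb; apply: lt_le_trans (alm b hb).
have rho01 b : 0 <= rho b < 1.
  rewrite /rho; case: ifP => hb; last by rewrite lexx ltr01.
  rewrite divr_ge0 // ?ltW ?alm0 //= ltr_pdivrMr ?alm0 // mul1r.
  by apply: lt_le_trans (alm b hb); rewrite /beta; lra.
pose V (w : seq 'I_d) := full_mean rho (gap_state n w) i.+1 n.
(* [V] falls by at most one per letter; adding the number of letters read gives increments in [0, 1]
   and drift at most [1 - beta]. *)
pose X (w : seq 'I_d) := V w + (size w)%:R.
have V0 : V [::] <= nR + s.
  rewrite /V full_mean_const // lerD2l.
  apply: (@le_trans _ _ (\sum_(b < i.+1) alpha i / delta)).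
    apply: ler_sum => b _; rewrite /rho ltn_ord.
    have h := alm b (ltn_ord b); have h0 := alm0 b (ltn_ord b).
    have hb : 0 < al b - beta by rewrite /beta; lra.
    have -> : beta / al b / (1 - beta / al b) = beta / (al b - beta).
      by field; rewrite !gt_eqF.
    rewrite ler_pdivrMr // mulrAC ler_pdivlMr //.
    by apply: ler_pM; [exact: ltW | exact: ltW | rewrite /beta; lra | rewrite /beta; lra].
  rewrite sumr_const card_ord -mulr_natl mulrA ler_pdivrMr // /delta mulrA sqr_s /s2.
  by rewrite mulfK ?gt_eqF //; apply: ler_wpM2r; [exact: ltW | rewrite ler_nat].
have eX w a : X (a :: w) - X w = 1 + (V (a :: w) - V w).
  by rewrite /X /= -natr1; ring.
(* The Bernoulli variance for mean [1 - beta] is at most [beta], which keeps the bound proportional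
   to [alpha i] although the mean is near 1. *)
have h := @expect_shift (fun w => alpha i * nR - (nR - g w)) X (1 - beta) beta (2 * s)
  _ (ltW be0) _ _ _ _ _.
apply: (le_trans (h _ _ _ _ _ _)).
- by rewrite subr_ge0.
- by have := mulr_ge0 (ltW be0) (ltW be0); lra.
- by have := s_gt0; lra.
- move=> w a _; rewrite eX; have dl := down_step_le.
  have h1 : V (a :: w) <= V w.
    by apply: full_mean_mono => // b _; apply: down_step_le; apply: gap_state_mono.
  have h2 : V w <= 1 + V (a :: w).
    apply: full_meanS => // b _; first exact: gap_state_le.
    by apply: leq_trans (leqSpred _) _; rewrite ltnS down_step_ge.
  by apply/andP; split; lra.
- move=> w hw.
  have h1 : \sum_a alpha a * (V (a :: w) - V w) <= - beta.
    pose G b := al b * (full_mean rho (down_step b (gap_state n w)) i.+1 n - V w).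
    have -> : \sum_a alpha a * (V (a :: w) - V w) = \sum_(b < d) G b.
      by apply: eq_bigr => a _; rewrite /G alE.
    rewrite (sum_ord_widen (ltn_ord i)) => [|b hb]; last first.
      have e j y : (j <= i.+1)%N ->
          tail rho (down_step b (gap_state n w)) j y = tail rho (gap_state n w) j y.
        move=> hj; apply: eq_tail => // c hc.
        by rewrite /down_step ltn_eqF // (leq_trans hc) // (leq_trans hj).
      rewrite /G /V /full_mean /trunc_mean (eq_bigr _ (fun y _ => e _ _ (leqnn _))).
      rewrite [X in _ + X - _](eq_bigr (fun b : 'I_i.+1 => rho b / (1 - rho b) *
        tail rho (gap_state n w) b.+1 n.+1)) ?subrr ?mulr0 // => c _.
      by rewrite e.
    apply: full_mean_down_drift => //.
    - exact: ltW.
    - by move=> b hb; rewrite /rho hb mulrCA divff ?mulr1 // gt_eqF ?alm0.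
    - by apply: leq_trans (gap_state_ge n w 0); rewrite subn_gt0.
    - exact: gap_state_mono.
    - by move=> b _; apply: gap_state_le.
  rewrite (eq_bigr (fun a => alpha a + alpha a * (V (a :: w) - V w))) => [|a _]; last first.
    by rewrite eX mulrDr mulr1.
  by rewrite big_split /= alpha_sum; lra.
- move=> w ew.
  have := full_mean_ge rho01 (gap_state_le n w i); rewrite -/(V w) -/(g w).
  by rewrite /X ew /beta -/nR /=; have := nde; have := V0; lra.
have := an_le; have := mulr_ge0 (ltW nR_gt0) (ltW de0).
rewrite exprMn expr2 [s ^+ 2]expr2 sqr_s /beta mulrBr; lra.
Qed.

Lemma row_second_moment :
  SW_expect n alpha (fun lam => ((lam i)%:R - alpha i * n%:R) ^+ 2) <= 22 * s2.
Proof.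
(* The deviations above and below contribute the constants 12 and 10. *)
pose F w := sqr_pos (C w - alpha i * nR) + sqr_pos (alpha i * nR - (nR - g w)).
apply: (@le_trans _ _ (expect alpha n F)).
  rewrite -expect_words; apply: ler_sum => w _; apply: ler_wpM2l.
    by apply: prodr_ge0 => t _.
  apply: le_trans (sqr_le_pos _) _; apply: lerD; apply: sqr_pos_mono.
    by rewrite lerD2r ler_nat shRSK_le.
  have : nR <= (shRSK w i)%:R + g (codom w) by rewrite /g -natrD ler_nat shRSK_ge.
  by rewrite -/nR; lra.
rewrite expectD; have := gap_lower; have : expect alpha n
    (fun w => sqr_pos (C w - alpha i * nR)) <= 12 * s2.
  have [/chain_upper_large //|/chain_upper_small] := leP 1 s2.
  by have := s2_gt0; lra.
lra.
Qed.

End Row.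

(** * Summation over the rows and comparison of the two distances *)

Unset Implicit Arguments.

Theorem mainTheorem5 (R : rcfType) (d n k : nat) (alpha : 'I_d -> R)
  (Halpha_nneg : forall i, 0 <= alpha i)
  (Halpha_sum : \sum_(i < d) alpha i = 1)
  (Halpha_mono : forall i j : 'I_d, (i <= j)%N -> alpha j <= alpha i)
  (Halpha_pos : forall i : 'I_d, (i < k)%N -> 0 < alpha i)
  (Hn : (1 <= n)%N) (Hk1 : (1 <= k)%N) (Hkd : (k <= d)%N) :
  SW_expect n alpha (fun lam =>
      \sum_(i < d | (i < k)%N) alpha i * (((lam i)%:R / n%:R) / alpha i - 1) ^+ 2)
    <= (46 * k * d)%:R / n%:R
  /\
  SW_expect n alpha (fun lam =>
      \sum_(i < d | (i < k)%N) (Num.sqrt ((lam i)%:R / n%:R) - Num.sqrt (alpha i)) ^+ 2)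
    <= (46 * k * d)%:R / n%:R.
Proof.
have n0 : 0 < n%:R :> R by rewrite ltr0n.
have mono F G : (forall lam, F lam <= G lam) ->
    SW_expect n alpha F <= SW_expect n alpha G.
  move=> FG; apply: ler_sum => w _; apply: ler_wpM2l; last exact: FG.
  by apply: prodr_ge0 => t _.
have chi2 : SW_expect n alpha (fun lam =>
      \sum_(i < d | (i < k)%N) alpha i * (((lam i)%:R / n%:R) / alpha i - 1) ^+ 2)
    <= (46 * k * d)%:R / n%:R.
  rewrite /SW_expect.
  under eq_bigr => w _ do rewrite mulr_sumr.
  rewrite exchange_big /=.
  (* Each term is the squared deviation of the row divided by [alpha i * n%:R ^+ 2], so its mean is
     at most 22 d / n. *)
  apply: (@le_trans _ _ (\sum_(i < d | (i < k)%N) (22 * d)%:R / n%:R)).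
    apply: ler_sum => i ik; have a0 := Halpha_pos i ik.
    have h := row_second_moment Halpha_nneg Halpha_sum Halpha_mono a0 Hn.
    rewrite (eq_bigr (fun w : {ffun 'I_n -> 'I_d} => (alpha i * n%:R ^+ 2)^-1 *
        ((\prod_t alpha (w t)) * ((shRSK w i)%:R - alpha i * n%:R) ^+ 2))); last first.
      by move=> w _; field; rewrite !gt_eqF.
    rewrite -mulr_sumr mulrC ler_pdivrMr ?mulr_gt0 ?exprn_gt0 //.
    apply: le_trans h _; rewrite le_eqVlt; apply/orP; left; apply/eqP.
    by rewrite natrM; field; rewrite gt_eqF.
  rewrite sumr_const -[leLHS]mulr_natl mulrA ler_pM2r ?invr_gt0 // -natrM ler_nat.
  have -> : #|(fun i : 'I_d => (i < k)%N)| = k.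
    rewrite -sum1_card -(big_ord_widen _ (fun=> 1%N) Hkd) sum1_card card_ord //.
  by rewrite mulnCA -mulnA leq_mul.
split=> //; apply: le_trans (mono _ _ _) chi2 => lam.
apply: ler_sum => i ik; have a0 := Halpha_pos i ik.
set x := _ / n%:R.
have x0 : 0 <= x by rewrite divr_ge0 // ltW.
have s0 := sqrtr_ge0 x; have t0 : 0 < Num.sqrt (alpha i) by rewrite sqrtr_gt0.
rewrite -{2}(sqr_sqrtr x0) -{2 3}(sqr_sqrtr (ltW a0)).
move: (Num.sqrt x) (Num.sqrt (alpha i)) s0 t0 => u v u0 v0.
(* The second distance is dominated term by term by the first, because [(u + v) / v >= 1]. *)
have -> : v ^+ 2 * (u ^+ 2 / v ^+ 2 - 1) ^+ 2 = (u - v) ^+ 2 * ((u + v) / v) ^+ 2.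
  by field; rewrite gt_eqF.
rewrite -[leLHS]mulr1; apply: ler_wpM2l; first exact: sqr_ge0.
by apply: exprn_ege1; rewrite ler_pdivlMr // mul1r lerDr.
Qed.
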